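(* Let $f=(f_1,f_2)\in\mathcal{G}$ be a two-player game. (1) Suppose $(\mathcal{X}_1,\mu_1)=(\mathcal{X}_2,\mu_2)$ and $f$ is zero-sum and symmetric. If $f$ is transitive, in the sense that $f_1(x,y)=\phi(x)-\phi(y)$ for all $x,y$, for some function $\phi$, then $f\in R_{\rho_T}$. If $f$ is cyclic, in the sense that $\int f_1(x,y)\,d\mu_2(y)=0$ for all $x\in\mathcal{X}_1$, then $f\in K_{\rho_T}=R_{\mathrm{Id}-\rho_T}$. (2) For arbitrary $(\mathcal{X}_1,\mu_1)$, $(\mathcal{X}_2,\mu_2)$, the game $f$ is trivial, in the sense that for $j=1,2$ there are functions $\phi_j,\lambda_j$ with $f_j(x,y)=\phi_j(x)+\lambda_j(y)$ for all $x,y$, if and only if $f\in R_{\rho_T}$. That is, the class of trivial games coincides with $R_{\rho_T}$.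
   Context: The pure strategy sets $\mathcal{X}_1,\mathcal{X}_2$ of the two players are probability spaces with probability measures $\mu_1,\mu_2$. $\mathcal{G}$ is the real vector space of two-player games, i.e. pairs $f=(f_1,f_2)$ of functions $\mathcal{X}_1\times\mathcal{X}_2\to\mathbb{R}$, where $f_j(x,y)$ is the payoff to player $j$ when the players play $x$ and $y$. The payoff functions are taken to be jointly measurable, $\mu_1\otimes\mu_2$-integrable, and such that $f_j(x,\cdot)\in L^1(\mu_2)$ for every $x$ and $f_j(\cdot,y)\in L^1(\mu_1)$ for every $y$, so that all integrals below are defined everywhere. For a function $g$ on $\mathcal{X}_1\times\mathcal{X}_2$: $\mathcal{N}_2g(x,y):=\int g(x,z)\,d\mu_2(z)$, $\mathcal{N}_1g(x,y):=\int g(z,y)\,d\mu_1(z)$, and $\widehat{\mathcal{N}}:=\mathcal{N}_1+\mathcal{N}_2-\mathcal{N}_1\mathcal{N}_2$. The operator $\rho_T:\mathcal{G}\to\mathcal{G}$ is $\rho_T(f_1,f_2):=(\widehat{\mathcal{N}}f_1,\widehat{\mathcal{N}}f_2)$. $K_\rho$ and $R_\rho$ denote the kernel and range of an operator $\rho$; $\mathrm{Id}$ is the identity. $f$ is zero-sum if $f_1=-f_2$. When the strategy spaces coincide, $g^T(x,y):=g(y,x)$ and $f$ is symmetric if $f_1=f_2^T$. *)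

(* Defs.v *)
From HB Require Import structures.
From mathcomp Require Import all_boot all_order all_algebra.
From mathcomp Require Import all_classical all_reals all_analysis measurable_realfun.

Set Implicit Arguments.
Unset Strict Implicit.
Unset Printing Implicit Defensive.
Import Order.TTheory GRing.Theory Num.Theory.
Local Open Scope classical_set_scope.
Local Open Scope ring_scope.

Section payoff.
Context (R : realType) (d1 d2 : measure_display).
Context (T1 : measurableType d1) (T2 : measurableType d2).
Variables (mu1 : probability T1 R) (mu2 : probability T2 R).

(* Joint measurability is part of the first condition. The type annotation on
   [g] avoids a universe clash with algebra-tactics' [ring] and [lra]. *)
Definition is_payoff : set (T1 * T2 -> R) := [set g : T1 * T2 -> R |
  [/\ (mu1 \x mu2)%E.-integrable setT (EFin \o g),
      forall x, mu2.-integrable setT (EFin \o (fun y => g (x, y))) &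
      forall y, mu1.-integrable setT (EFin \o (fun x => g (x, y)))]].

Definition payoff_pred : {pred T1 * T2 -> R} := mem is_payoff.

Let integrable_lin (d : measure_display) (T : measurableType d)
    (mu : {measure set T -> \bar R}) (a : R) (f g : T -> R) :
  mu.-integrable setT (EFin \o f) -> mu.-integrable setT (EFin \o g) ->
  mu.-integrable setT (EFin \o (fun x => a * f x + g x)).
Proof.
move=> fi gi.
exact: (integrableD measurableT (integrableZl measurableT a fi) gi).
Qed.

Lemma payoff_submod_closed : submod_closed payoff_pred.
Proof.
split; first by rewrite inE; split=> *; exact: integrable0.
move=> a f g; rewrite !inE => -[f0 f1 f2] [g0 g1 g2].
by split=> [|x|y]; exact: integrable_lin.
Qed.

HB.instance Definition _ :=
  GRing.isSubmodClosed.Build R (T1 * T2 -> R)%type payoff_pred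
    payoff_submod_closed.

Record payoff := Payoff {
  payoff_fun :> T1 * T2 -> R;
  payoff_funP : payoff_fun \in payoff_pred }.

HB.instance Definition _ := [isSub for payoff_fun].
HB.instance Definition _ := [Choice of payoff by <:].
HB.instance Definition _ := [SubChoice_isSubLmodule of payoff by <:].

Definition game := (payoff * payoff)%type.

Let fineE (d : measure_display) (T : measurableType d) (mu : probability T R)
    (h : T -> R) : mu.-integrable setT (EFin \o h) ->
  (\int[mu]_x h x)%:E = (\int[mu]_x (h x)%:E)%E.
Proof. by move=> ih; rewrite fineK//; exact: integrable_fin_num. Qed.

Let cst_int (d : measure_display) (T : measurableType d) (mu : probability T R)
    (r : R) : mu.-integrable setT (EFin \o cst r).
Proof. exact: finite_measure_integrable_cst. Qed.

Let integrable_fst (h : T1 -> R) : mu1.-integrable setT (EFin \o h) ->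
  (mu1 \x mu2)%E.-integrable setT (EFin \o (h \o fst)).
Proof.
move=> ih; have /measurable_EFinP mh := measurable_int mu1 ih.
apply/integrable12ltyP.
  by apply/measurable_EFinP; exact: measurableT_comp.
rewrite [ltLHS](_ : _ = \int[mu1]_x `|(h x)%:E|)%E.
  by have /integrableP[] := ih.
apply: eq_integral => x _ /=.
by rewrite integral_cst// [X in (_ * X)%E]probability_setT mule1.
Qed.

Let integrable_snd (h : T2 -> R) : mu2.-integrable setT (EFin \o h) ->
  (mu1 \x mu2)%E.-integrable setT (EFin \o (h \o snd)).
Proof.
move=> ih; have /measurable_EFinP mh := measurable_int mu2 ih.
apply/integrable21ltyP.
  by apply/measurable_EFinP; exact: measurableT_comp.
rewrite [ltLHS](_ : _ = \int[mu2]_x `|(h x)%:E|)%E.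
  by have /integrableP[] := ih.
apply: eq_integral => x _ /=.
by rewrite integral_cst// [X in (_ * X)%E]probability_setT mule1.
Qed.

Definition avg2_fun (g : T1 * T2 -> R) (p : T1 * T2) : R :=
  \int[mu2]_z g (p.1, z).

Definition avg1_fun (g : T1 * T2 -> R) (p : T1 * T2) : R :=
  \int[mu1]_z g (z, p.2).

Lemma avg2_subproof (g : payoff) : avg2_fun g \in payoff_pred.
Proof.
case: g => g /=; rewrite !inE => -[g0 g1 g2].
have ih : mu1.-integrable setT (EFin \o (fun x => \int[mu2]_z g (x, z))).
  have -> : EFin \o (fun x => \int[mu2]_z g (x, z)) =
      fubini_F mu2 (EFin \o g) by apply/funext => x; exact: fineE (g1 x).
  exact: (integrable_fubini_F g0).
split=> [|x|y]; [exact: (integrable_fst ih)| |exact: ih].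
exact: (cst_int mu2 (\int[mu2]_z g (x, z))).
Qed.

Lemma avg1_subproof (g : payoff) : avg1_fun g \in payoff_pred.
Proof.
case: g => g /=; rewrite !inE => -[g0 g1 g2].
have ih : mu2.-integrable setT (EFin \o (fun y => \int[mu1]_z g (z, y))).
  have -> : EFin \o (fun y => \int[mu1]_z g (z, y)) =
      fubini_G mu1 (EFin \o g) by apply/funext => y; exact: fineE (g2 y).
  have mg := measurable_int _ g0.
  have /integrable21ltyP := g0 => /(_ mg) g_fin.
  apply/integrableP; split; first exact: (measurable_fubini_G g0).
  apply: le_lt_trans g_fin; apply: ge0_le_integral => //.
  - by apply: measurableT_comp => //; exact: (measurable_fubini_G g0).
  - apply: (measurable_fun_fubini_tonelli_G (m1 := mu1)
      (abse \o (EFin \o g))) => //=.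
    exact: measurableT_comp.
  - move=> y _; apply: le_abse_integral => //.
    exact: (measurable_int _ (g2 y)).
split=> [|x|y]; [exact: (integrable_snd ih)|exact: ih|].
exact: (cst_int mu1 (\int[mu1]_z g (z, y))).
Qed.

(* [avg1], [avg2] and [avg_hat] are N_1, N_2 and N-hat. *)
Definition avg2 (g : payoff) : payoff := Payoff (avg2_subproof g).

Definition avg1 (g : payoff) : payoff := Payoff (avg1_subproof g).

Definition avg_hat (g : payoff) : payoff := avg1 g + avg2 g - avg1 (avg2 g).

Definition rhoT (f : game) : game := (avg_hat f.1, avg_hat f.2).

Definition ker_op (rho : game -> game) : set game := [set f | rho f = 0].

Definition trivial_game (f : game) : Prop :=
  (exists (phi : T1 -> R) (lambda : T2 -> R),
     forall x y, f.1 (x, y) = phi x + lambda y) /\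
  (exists (phi : T1 -> R) (lambda : T2 -> R),
     forall x y, f.2 (x, y) = phi x + lambda y).

Definition zero_sum (f : game) : Prop := f.1 = - f.2.

Definition cyclic_game (f : game) : Prop :=
  forall x, \int[mu2]_y f.1 (x, y) = 0.

End payoff.

Arguments rhoT {R d1 d2 T1 T2} mu1 mu2 f.

Section same_space.
Context (R : realType) (d : measure_display) (T : measurableType d).
Variable mu : probability T R.

Definition transpose (g : T * T -> R) : T * T -> R := fun p => g (p.2, p.1).

Definition symmetric_game (f : game mu mu) : Prop :=
  (f.1 : T * T -> R) = transpose f.2.

Definition transitive_game (f : game mu mu) : Prop :=
  exists phi : T -> R, forall x y, f.1 (x, y) = phi x - phi y.

End same_space.

(* Main.v *)
(** An additively separable payoff g satisfies
    g(u, v) = g(u, y) + g(x, v) - g(x, y); integrating over u and v gives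
    N-hat g = g. Conversely N-hat g is always separable. Hence rho_T is an
    idempotent linear map whose range is the class of trivial games, and its
    kernel is the range of Id - rho_T. A symmetric zero-sum game has f_1
    antisymmetric, so a cyclic one has both marginals zero. *)

Require Import Defs.
From HB Require Import structures.
From mathcomp Require Import all_boot all_order all_algebra.
From mathcomp Require Import all_classical all_reals all_analysis.
Import Order.TTheory GRing.Theory Num.Theory.
Local Open Scope classical_set_scope.
Local Open Scope ring_scope.

Section averages.
Context (R : realType) (d1 d2 : measure_display).
Context (T1 : measurableType d1) (T2 : measurableType d2).
Variables (mu1 : probability T1 R) (mu2 : probability T2 R).
Implicit Types (g h : payoff mu1 mu2) (f : game mu1 mu2).

Lemma payoff_ext g h : (forall x y, g (x, y) = h (x, y)) -> g = h.
Proof. by move=> gh; apply/val_inj/funext => -[x y]; exact: gh. Qed.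

Lemma payoff_integrable2 g x :
  mu2.-integrable setT (EFin \o (fun y => g (x, y))).
Proof. by have := payoff_funP g; rewrite inE => -[_ + _]; exact. Qed.

Lemma payoff_integrable1 g y :
  mu1.-integrable setT (EFin \o (fun x => g (x, y))).
Proof. by have := payoff_funP g; rewrite inE => -[_ _]; exact. Qed.

(** Every section of a payoff is integrable, not just almost every one, so linearity of the integral
    holds at each point and gives equality of payoffs. *)
Lemma avg1B g h : avg1 (g - h) = avg1 g - avg1 h.
Proof.
apply: payoff_ext => x y.
exact: (RintegralB measurableT (payoff_integrable1 g y) (payoff_integrable1 h y)).
Qed.

Lemma avg2B g h : avg2 (g - h) = avg2 g - avg2 h.
Proof.
apply: payoff_ext => x y.
exact: (RintegralB measurableT (payoff_integrable2 g x) (payoff_integrable2 h x)).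
Qed.

Lemma avg_hatB g h : avg_hat (g - h) = avg_hat g - avg_hat h.
Proof. by rewrite /avg_hat !(avg1B, avg2B) (addrACA (avg1 g)) !opprD !opprK
  (addrACA (avg1 g + avg2 g)). Qed.

Lemma avg_hatE g x y : avg_hat g (x, y) =
  \int[mu1]_z g (z, y) + \int[mu2]_z g (x, z)
  - \int[mu1]_w \int[mu2]_z g (w, z).
Proof. by []. Qed.

Lemma Rintegral_add_cst (d : measure_display) (T : measurableType d)
    (mu : probability T R) (u : T -> R) (c : R) :
  mu.-integrable setT (EFin \o u) ->
  \int[mu]_x (u x + c) = \int[mu]_x u x + c.
Proof.
move=> iu; rewrite RintegralD//; last exact: finite_measure_integrable_cst.
by rewrite Rintegral_cst// [X in fine X]probability_setT mulr1.
Qed.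

(** This is one conjunct of [trivial_game], so the two components of a game can be treated
    separately. *)
Definition separable_payoff g := exists (phi : T1 -> R) (lambda : T2 -> R),
  forall x y, g (x, y) = phi x + lambda y.

(** [avg1 g] depends on [y] alone, [avg2 g] on [x] alone, and [avg1 (avg2 g)] is a constant,
    absorbed here into [phi]. *)
Lemma avg_hat_separable g : separable_payoff (avg_hat g).
Proof.
exists (fun x => \int[mu2]_z g (x, z) - \int[mu1]_w \int[mu2]_z g (w, z)).
exists (fun y => \int[mu1]_z g (z, y)) => x y.
by rewrite avg_hatE -addrA addrC.
Qed.

Lemma separable_avg_hat g : separable_payoff g -> avg_hat g = g.
Proof.
move=> [phi [lambda gE]]; apply: payoff_ext => x y; rewrite avg_hatE.
(* This eliminates [phi] and [lambda], which carry no integrability assumption: from here on only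
   sections of [g] are integrated. *)
have gD u v : g (u, v) = g (x, v) + (g (u, y) - g (x, y)).
  by rewrite !gE (addrC (phi x) (lambda y)) addrKA [RHS]addrC subrKA.
(* Integrating [gD] in its second variable leaves one section of [g] plus a constant in [w]. The
   outer integral then makes the double integral equal to both marginals at [(x, y)] minus
   [g (x, y)]. *)
have -> : \int[mu1]_w \int[mu2]_z g (w, z) =
    \int[mu1]_w (g (w, y) + (\int[mu2]_z g (x, z) - g (x, y))).
  apply: eq_Rintegral => w _.
  rewrite addrCA -Rintegral_add_cst; last exact: payoff_integrable2.
  by apply: eq_Rintegral => z _; exact: gD.
rewrite Rintegral_add_cst; last exact: payoff_integrable1.
by rewrite addrA subKr.
Qed.

Lemma rhoTB f f' : rhoT mu1 mu2 (f - f') = rhoT mu1 mu2 f - rhoT mu1 mu2 f'.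
Proof. by case: f f' => [f1 f2] [f1' f2']; rewrite /rhoT /= !avg_hatB. Qed.

Lemma rhoT_trivial f : trivial_game f -> rhoT mu1 mu2 f = f.
Proof. by case: f => f1 f2 [s1 s2]; rewrite /rhoT !separable_avg_hat. Qed.

Lemma trivial_rhoT f : trivial_game (rhoT mu1 mu2 f).
Proof. by split; exact: avg_hat_separable. Qed.

Lemma trivial_game_range f : trivial_game f <-> range (rhoT mu1 mu2) f.
Proof.
split=> [/rhoT_trivial <-|[g _ <-]]; [by exists f|exact: trivial_rhoT].
Qed.

Lemma ker_rhoT :
  ker_op (rhoT mu1 mu2) = range (fun g : game mu1 mu2 => g - rhoT mu1 mu2 g).
Proof.
apply/seteqP; split=> [f /= f0|_ [g _ <-]].
  by exists f => //; rewrite f0 subr0.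
(* Idempotence: [rhoT g] is trivial, hence fixed by [rhoT]. *)
by rewrite /ker_op /= rhoTB (rhoT_trivial _ (trivial_rhoT g)) subrr.
Qed.

End averages.

Section zero_sum_symmetric.
Context (R : realType) (d : measure_display) (T : measurableType d).
Variables (mu : probability T R) (f : game mu mu).
Hypotheses (f_zero_sum : zero_sum f) (f_sym : symmetric_game f).

Lemma zero_sumE p : f.2 p = - f.1 p.
Proof. by rewrite f_zero_sum [RHS]opprK. Qed.

Lemma zero_sum_symmetric_anti x y : f.1 (x, y) = - f.1 (y, x).
Proof. by rewrite -zero_sumE f_sym. Qed.

Lemma transitive_trivial : transitive_game f -> trivial_game f.
Proof.
move=> [phi f1E]; split; first by exists phi, (fun y => - phi y).
by exists (fun x => - phi x), phi => x y; rewrite zero_sumE f1E opprB addrC.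
Qed.

Lemma cyclic_ker : cyclic_game f -> ker_op (rhoT mu mu) f.
Proof.
move=> cyc.
have avg_hat1 : avg_hat f.1 = 0.
  apply: payoff_ext => x y; rewrite avg_hatE cyc.
  under [X in _ - X]eq_Rintegral do rewrite cyc.
  (* Antisymmetry turns the column integral at [y] into minus the row integral at [y], which
     vanishes by cyclicity. *)
  under [X in X + _ - _]eq_Rintegral do
    rewrite zero_sum_symmetric_anti -mulN1r.
  rewrite RintegralZl//; last exact: payoff_integrable2.
  by rewrite cyc mulr0 Rintegral_cst// mul0r subr0 addr0.
rewrite /ker_op /= /rhoT avg_hat1.
(* The opposite of [f.1] is written with subtractions only, so that [avg_hatB] applies. *)
have -> : f.2 = f.1 - f.1 - f.1 by rewrite subrr add0r f_zero_sum opprK.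
by rewrite !avg_hatB avg_hat1 !subr0.
Qed.

End zero_sum_symmetric.

Theorem proposition3p5 (R : realType) :
  (forall (d : measure_display) (T : measurableType d) (mu : probability T R)
      (f : game mu mu),
    zero_sum f -> symmetric_game f ->
      (transitive_game f -> range (rhoT mu mu) f) /\
      (cyclic_game f ->
        ker_op (rhoT mu mu) f /\
        ker_op (rhoT mu mu) =
          range (fun g : game mu mu => g - rhoT mu mu g))) /\
  (forall (d1 d2 : measure_display)
      (T1 : measurableType d1) (T2 : measurableType d2)
      (mu1 : probability T1 R) (mu2 : probability T2 R),
    (forall f : game mu1 mu2,
       trivial_game f <-> range (rhoT mu1 mu2) f) /\
    [set f : game mu1 mu2 | trivial_game f] =
      range (rhoT mu1 mu2)).
Proof.
split=> [d T mu f zs sym|d1 d2 T1 T2 mu1 mu2].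
  split=> [/(transitive_trivial _ _ _ _ _ zs)/trivial_game_range//|cyc].
  by split; [exact: cyclic_ker|exact: ker_rhoT].
by split=> [f|]; [|apply/funext => f; apply/propext]; exact: trivial_game_range.
Qed.
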